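(* Let $V\subseteq\mathbb{R}_+$ be non-empty and density-open and let $f:\mathbb{R}_+\to\mathbb{R}$ be Lebesgue measurable. Suppose that for each $x\in V$ $$\sup\{f(qx): q\in\mathbb{Q}_+\}<\infty .$$ Then $f$ is essentially bounded at infinity (in the measure sense). The category version also holds: if $V\subseteq\mathbb{R}_+$ is non-empty and open in the Euclidean topology, $f:\mathbb{R}_+\to\mathbb{R}$ has the Baire property, and $\sup\{f(qx):q\in\mathbb{Q}_+\}<\infty$ for each $x\in V$, then $f$ is essentially bounded at infinity in the category sense.
   Context: $\mathbb{R}_+=(0,\infty)$; $\mathbb{Q}_+$ is the set of positive rationals. A measurable set is density-open if each of its points $t$ is a density point of it, where $t$ is a density point of $T$ if $\lim_{\delta\downarrow0}|T\cap(t-\delta/2,t+\delta/2)|/\delta=1$. A function $f$ is essentially bounded at infinity if there is a real $M$ with $\operatorname{ess\,sup}_{(n,\infty)}f\le M$ for all large enough $n$, i.e. $\limsup_{n\to\infty}[\operatorname{ess\,sup}_{(n,\infty)}f]<\infty$. In the measure sense, $\operatorname{ess\,sup}$ is taken modulo Lebesgue null sets; in the category sense, modulo meagre sets. A function has the Baire property if preimages of open sets have the Baire property. *)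

(* Defs.v *)
From HB Require Import structures.
From mathcomp Require Import all_boot all_order all_algebra.
From mathcomp Require Import all_classical all_reals all_analysis.
From mathcomp Require Import ess_sup_inf.

Set Implicit Arguments.
Unset Strict Implicit.
Unset Printing Implicit Defensive.

Import Order.TTheory GRing.Theory Num.Theory.
Import numFieldNormedType.Exports.

Local Open Scope classical_set_scope.
Local Open Scope ring_scope.

(* A function on the positive half-line is represented by f : R -> R; the
   definitions below only look at its values on `]0, +oo[. *)

(* The canonical sigma-algebra on R is the Borel one. Lebesgue measurability
   refers to this copy of R, which carries the domain sigma-algebra of
   completed_lebesgue_measure. *)
Notation lebesgueTypeR R :=
  (caratheodory_type ((wlength (@idfun R))^*)%mu).

Definition rat_orbit_sup {R : realType} (f : R -> R) (x : R) : \bar R :=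
  ereal_sup [set (f (ratr q * x))%:E | q in [set q : rat | 0 < q]].

Section measure.
Context {R : realType}.
Local Notation mu := (@completed_lebesgue_measure R).

Definition lebesgue_measurable (A : set R) : Prop :=
  measurable (A : set (lebesgueTypeR R)).

Lemma lebesgue_measurable_itv (i : interval R) : lebesgue_measurable [set` i].
Proof.
apply: sub_caratheodory.
exact: (@measurable_itv R i).
Qed.

Definition lebesgue_measurable_fun_pos (f : R -> R) : Prop :=
  measurable_fun (`]0, +oo[%classic : set (lebesgueTypeR R))
                 (f : lebesgueTypeR R -> measurableTypeR R).

Definition density_point (T : set R) (t : R) : Prop :=
  (mu (T `&` [set` `]t - d / 2, t + d / 2[%R]) * (d^-1)%:E)%E
    @[d --> 0^'+] --> 1%E.

Definition density_open (T : set R) : Prop :=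
  lebesgue_measurable T /\ (forall t, T t -> density_point T t).

Definition ess_sup_above (f : R -> R) (a : R) : \bar R :=
  ess_sup (mrestr mu (lebesgue_measurable_itv `]a, +oo[)) (EFin \o f).

End measure.

Section category.
Context {T : topologicalType}.
Implicit Type A : set T.

Definition nowhere_dense A : Prop := (closure A)° = set0.

Definition meagre A : Prop :=
  exists2 F : (set T)^nat, (forall n, nowhere_dense (F n)) & A = \bigcup_n F n.

Definition baire_property A : Prop :=
  exists2 U : set T, open U & meagre (A `+` U).

End category.

Section category_real.
Context {R : realType}.

(* As `]0, +oo[ is open in R, being meagre or having the Baire property is the
   same for its subsets whether they are considered in `]0, +oo[ or in R. *)
Definition baire_property_fun_pos (f : R -> R) : Prop :=
  forall U : set R, open U -> baire_property (`]0, +oo[ `&` f @^-1` U).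

Definition category_ess_sup_above (f : R -> R) (a : R) : \bar R :=
  ereal_inf [set y : \bar R |
    meagre (`]a, +oo[ `&` ~` [set x | ((f x)%:E <= y)%E])].

(* S a is meant to be the essential supremum of a function on (a, oo), in the
   measure sense or in the category sense. *)
Definition bounded_at_infinity (S : R -> \bar R) : Prop :=
  exists M : R, \forall n \near \oo, (S n%:R <= M%:E)%E.

Definition ess_bounded_at_infinity (f : R -> R) : Prop :=
  bounded_at_infinity (ess_sup_above f).

Definition category_ess_bounded_at_infinity (f : R -> R) : Prop :=
  bounded_at_infinity (category_ess_sup_above f).

End category_real.

(* Main.v *)
Require Import Defs.
From mathcomp Require Import all_boot all_order all_algebra.
From mathcomp Require Import all_classical all_reals all_analysis.
From mathcomp Require Import measurable_realfun.
From mathcomp Require Import ring lra.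
Import Order.TTheory GRing.Theory Num.Theory.
Import numFieldNormedType.Exports.

(** The two halves share one idea. Let P_n be the set of x > 0 with f x > n,
and call rational saturation of a set A the union of all its dilates by
positive rationals. A point with a bounded rational orbit avoids the saturation
of P_n for some n, so V is covered by the complements of these saturations.
Saturations are invariant under the dense group of positive rationals, so a
zero-one law applies: a saturation that misses a large set is negligible. As V
is large, one of the complements is large, hence the saturation of that P_n is
negligible, and so is P_n itself. Thus f <= n almost everywhere on the whole
half-line.

In the category case P_n may be replaced, modulo a meagre set, by an open set
G_n. If G_n meets the half-line then its saturation is open and dense there
([rat_saturation_codense]). If this happened for every n, the covering of V
would make V meagre, against the Baire category theorem ([open_meagre0]).

In the measure case P_n lies between a Borel set X_n and the union of X_n with
a Borel null set ([lebesgue_measurable_decomp]). The part of the half-line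
outside the saturation of X_n has positive measure for some n, since a null set
has no density-open subset but the empty one ([density_point_nonnull]). The zero-one
law comes from a Steinhaus property: of two Borel subsets of the half-line with
positive measure, some positive rational dilates a point of one to a point of
the other ([rat_ratio_measure_gt0]). An invariant set and its complement cannot
both have positive measure, so X_n is null. *)

Set Implicit Arguments.
Unset Strict Implicit.
Unset Printing Implicit Defensive.

Local Open Scope classical_set_scope.
Local Open Scope ring_scope.

(** * Saturation under positive rational dilations *)

Section saturation.
Context {R : realType}.
Implicit Types (A B : set R) (f : R -> R) (x : R).

Definition rat_saturation A : set R :=
  [set x | exists2 q : rat, 0 < q & A (ratr q * x)].

Definition superlevel f (n : nat) : set R := `]0, +oo[ `&` f @^-1` `]n%:R, +oo[.

Lemma sub_rat_saturation A : A `<=` rat_saturation A.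
Proof. by move=> x Ax; exists 1 => //; rewrite rmorph1 mul1r. Qed.

Lemma rat_saturation_scale A (q : rat) x : 0 < q ->
  rat_saturation A (ratr q * x) <-> rat_saturation A x.
Proof.
move=> q0; split=> -[p p0 Ap].
  by exists (p * q); rewrite ?mulr_gt0// rmorphM -mulrA.
exists (p / q); first by rewrite divr_gt0.
by rewrite mulrA -rmorphM divfK ?gt_eqF.
Qed.

(** An enumeration with repetitions, junk indices being sent to 1, so that
saturations become unions over nat. *)
Definition pos_rat (n : nat) : rat :=
  let q : rat := odflt 1 (unpickle n) in if 0 < q then q else 1.

Lemma pos_rat_gt0 n : 0 < pos_rat n.
Proof. by rewrite /pos_rat; case: ifP. Qed.

Lemma rat_saturationE A :
  rat_saturation A = \bigcup_n [set x | A (ratr (pos_rat n) * x)].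
Proof.
apply/seteqP; split=> [x [q q0 Aq]|x [n _ An]].
  by exists (pickle q) => //=; rewrite /pos_rat pickleK /= q0.
by exists (pos_rat n) => //; exact: pos_rat_gt0.
Qed.

Lemma rat_orbit_sup_superlevel f x : (rat_orbit_sup f x < +oo)%E ->
  exists n, ~ rat_saturation (superlevel f n) x.
Proof.
move=> supf; have [M fM] : exists M : R,
    forall q : rat, 0 < q -> f (ratr q * x) <= M.
  have fq q : 0 < q -> ((f (ratr q * x))%:E <= rat_orbit_sup f x)%E.
    by move=> q0; apply: ereal_sup_ubound; exists q.
  case: (rat_orbit_sup f x) supf fq => [M _ fq|//|_ fq].
    by exists M => q /fq; rewrite lee_fin.
  by have := fq 1 ltr01; rewrite leeNy_eq.
exists (Num.trunc `|M|).+1 => -[q q0 [_]] /=; rewrite in_itv /= andbT ltNge.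
move/negP; apply; apply: (le_trans (fM q q0)); apply: (le_trans (ler_norm M)).
exact/ltW/Num.Theory.truncnS_gt.
Qed.

End saturation.

(** * The category case *)

Section meagre.
Context {T : topologicalType}.
Implicit Types A B : set T.

Lemma nowhere_denseP A :
  nowhere_dense A <-> forall O, open O -> O `<=` closure A -> O = set0.
Proof.
split=> [A0 O oO|H]; last first.
  exact: (H _ (@open_interior _ _) (@interior_subset _ _)).
by rewrite open_subsetE// A0 subset0.
Qed.

Lemma nowhere_dense0 : nowhere_dense (@set0 T).
Proof. by rewrite /nowhere_dense closure0 interior0. Qed.

Lemma nowhere_denseS A B : A `<=` B -> nowhere_dense B -> nowhere_dense A.
Proof.
move=> AB; rewrite /nowhere_dense -!subset0; apply: subset_trans.
exact/interiorS/closureS.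
Qed.

Lemma meagreS A B : A `<=` B -> meagre B -> meagre A.
Proof.
move=> AB [F nF BF]; exists (fun n => A `&` F n) => [n|].
  exact: nowhere_denseS (nF n).
by rewrite -setI_bigcupr -BF; apply/esym/setIidl.
Qed.

Lemma nowhere_dense_meagre A : nowhere_dense A -> meagre A.
Proof. by move=> nA; exists (fun=> A) => //; rewrite bigcup_const. Qed.

Lemma meagre_bigcup (F : (set T)^nat) :
  (forall n, meagre (F n)) -> meagre (\bigcup_n F n).
Proof.
move=> mF; have /choice[G /all_and2[nG FG]] n : exists G : (set T)^nat,
    (forall k, nowhere_dense (G k)) /\ F n = \bigcup_k G k.
  by have [G] := mF n; exists G.
exists (fun m => if unpickle m is Some nk then G nk.1 nk.2 else set0).
  move=> m; case: unpickle => [nk|]; [exact: nG|exact: nowhere_dense0].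
apply/seteqP; split=> [x [n _]|x [m _]].
  by rewrite FG => -[k _ Gx]; exists (pickle (n, k)) => //=; rewrite pickleK.
by case: unpickle => // -[n k] Gx; exists n => //; rewrite FG; exists k.
Qed.

Lemma meagreU A B : meagre A -> meagre B -> meagre (A `|` B).
Proof.
move=> mA mB; rewrite -bigcup2E; apply: meagre_bigcup => -[|[|n]] //=.
exact: nowhere_dense_meagre nowhere_dense0.
Qed.

End meagre.

Lemma nowhere_dense_preimage (T U : topologicalType) (g : T -> U) (h : U -> T)
    (A : set U) : continuous g -> continuous h -> cancel g h -> cancel h g ->
  nowhere_dense A -> nowhere_dense (g @^-1` A).
Proof.
move=> cg ch gK hK /nowhere_denseP nA; apply/nowhere_denseP => O oO OgA.
have cgA : closure (g @^-1` A) `<=` g @^-1` closure A.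
  rewrite [X in _ `<=` X](closure_id _).1; last first.
    by apply: closed_comp (@closed_closure _ A) => x _; exact: cg.
  by apply: closureS => x; exact: (@subset_closure _ A).
have hO0 : h @^-1` O = set0.
  apply: nA; first by apply: open_comp oO => x _; exact: ch.
  by move=> y /OgA /cgA /=; rewrite hK.
by rewrite -subset0 => x Ox; suff : (h @^-1` O) (g x);
  [rewrite hO0|rewrite /= gK].
Qed.

Section meagre_real.
Context {R : realType}.
Implicit Types A : set R.

Lemma meagre_scale A (a : R) : a != 0 -> meagre A -> meagre [set x | A (a * x)].
Proof.
move=> a0 [F nF ->]; exists (fun n => [set x | F n (a * x)]) => // n.
apply: (@nowhere_dense_preimage _ _ ( *%R a) ( *%R a^-1)); last exact: nF.
- exact: mulrl_continuous.
- exact: mulrl_continuous.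
- by move=> x; rewrite mulKf.
- by move=> x; rewrite mulVKf.
Qed.

Lemma meagre_rat_saturation A : meagre A -> meagre (rat_saturation A).
Proof.
move=> mA; rewrite rat_saturationE; apply: meagre_bigcup => n.
by apply: meagre_scale => //; rewrite gt_eqF// ltr0q pos_rat_gt0.
Qed.

Lemma open_rat_saturation A : open A -> open (rat_saturation A).
Proof.
move=> oA; rewrite rat_saturationE; apply: bigcup_open => n _.
by apply: (@open_comp R R ( *%R (ratr (pos_rat n))) A) => // x _;
  exact: mulrl_continuous.
Qed.

(** The Baire category theorem for the line, applied to the complements of the
closures of the nowhere dense pieces. *)
Lemma open_meagre0 (O : set R) : open O -> meagre O -> O = set0.
Proof.
move=> oO [F nF OF]; apply/eqP/negPn/negP => /set0P O0.
have [|x [Ox nFx]] := @Baire R R (fun n => ~` closure (F n)) _ O O0 oO.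
  move=> n; split; first exact/closed_openC/closed_closure.
  move=> W W0 oW; apply/set0P/negP => /eqP /disjoints_subset.
  rewrite setCK => WF.
  by move/set0P : W0; rewrite ((nowhere_denseP _).1 (nF n) W)// eqxx.
move: Ox; rewrite OF => -[n _ Fx]; apply: (nFx n) => //; exact: subset_closure.
Qed.

Lemma open_rat_multiple (a b : R) (W : set R) : open W -> W a ->
    0 < a -> 0 < b ->
  exists2 q : rat, 0 < q & W (ratr q * b).
Proof.
move=> oW Wa a0 b0; have: open ((fun x => x * b) @^-1` (W `&` `]0, +oo[)).
  apply: open_comp; first by move=> x _; exact: mulrr_continuous.
  by apply: openI => //; exact: interval_open.
move=> /(@dense_rat R _ _)[|x].
  by exists (a / b); rewrite /= divfK ?gt_eqF//; split=> //;
    rewrite in_itv/= a0.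
move=> [[Wx]]; rewrite /= in_itv/= andbT pmulr_lgt0// => x0 [q _ qx].
by exists q; rewrite ?qx// -(ltr0q R) qx.
Qed.

(** Every positive y has a rational multiple in G, since the rationals are
dense; hence the saturation of G is dense in the half-line, and it is open. *)
Lemma rat_saturation_codense (G : set R) : open G -> G `&` `]0, +oo[ !=set0 ->
  nowhere_dense (`]0, +oo[ `\` rat_saturation G).
Proof.
move=> oG [g [Gg]]; rewrite /= in_itv/= andbT => g0.
apply/nowhere_denseP => O oO Osub; apply/eqP/negPn/negP => /set0P[y Oy].
have [z []] := Osub _ Oy O (open_nbhs_nbhs (conj oO Oy)).
rewrite /= in_itv/= andbT => -[z0 _] Oz.
have [q q0 Gq] := @open_rat_multiple g z _ oG Gg g0 z0.
have [] := Osub _ Oz (O `&` rat_saturation G); last by move=> w [[_ nG] [_ Gw]].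
apply: open_nbhs_nbhs; split; last by split=> //; exists q.
by apply: openI => //; exact: open_rat_saturation.
Qed.

Lemma category_ess_bounded_of_rat_orbits (V : set R) (f : R -> R) :
  V `<=` `]0, +oo[ -> V !=set0 -> open V ->
  baire_property_fun_pos f ->
  (forall x, V x -> (rat_orbit_sup f x < +oo)%E) ->
  category_ess_bounded_at_infinity f.
Proof.
move=> Vpos [v Vv] oV bf supf.
have bP n : baire_property (superlevel f n) by apply: bf; exact: interval_open.
have /choice[G /all_and2[oG mG]] n : exists G : set R,
    open G /\ meagre (superlevel f n `+` G).
  by have [G] := bP n; exists G.
have [n Gn0] : exists n, G n `&` `]0, +oo[ = set0.
  apply: contrapT => /forallNP Gn.
  have /(open_meagre0 oV) V0 : meagre V; last by move: Vv; rewrite V0.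
  (* A point of V outside the saturation of superlevel f n can only meet that
     of G n through the meagre difference. *)
  apply: (@meagreS _ _ (\bigcup_n (`]0, +oo[ `\` rat_saturation (G n) `|`
      rat_saturation (superlevel f n `+` G n)))).
    move=> x Vx; have [n Pnx] := rat_orbit_sup_superlevel (supf x Vx).
    exists n => //; have [[q q0 Gq]|] := pselect (rat_saturation (G n) x).
      by right; exists q => //; right; split=> // Pq; apply: Pnx; exists q.
    by left; split=> //; exact: Vpos.
  apply: meagre_bigcup => n; apply: meagreU; last exact: meagre_rat_saturation.
  apply/nowhere_dense_meagre/rat_saturation_codense => //.
  exact/set0P/eqP.
exists n%:R; near=> m; apply: ereal_inf_lbound => /=.
apply: meagreS (mG n) => x [/= ]; rewrite in_itv/= andbT lee_fin => mx fx.
have x0 : 0 < x by exact: le_lt_trans mx.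
left; split; last first.
  by move=> Gx; suff : set0 x by []; rewrite -Gn0;
    split => //; rewrite /= in_itv/= x0.
by split; rewrite /= in_itv/= ?x0// andbT ltNge; apply/negP.
Unshelve. all: by end_near. Qed.

End meagre_real.

(** * The measure case *)

Section scaling.
Context {R : realType}.
Local Notation mu := (@lebesgue_measure R).
Implicit Types A B : set R.

Lemma measurable_scale A (a : R) :
  measurable A -> measurable [set x | A (a * x)].
Proof.
move=> mA; rewrite -[X in measurable X]setTI.
exact: (mulrl_measurable a).
Qed.

(** Both sides are Borel measures in A that agree on the half-open intervals,
hence, by uniqueness of the extension, on all Borel sets. *)
Lemma lebesgue_measure_scale A (a : R) : measurable A -> 0 < a ->
  mu A = (a%:E * mu [set x | A (a * x)%R])%E.
Proof.
move=> mA a0; pose g : R -> measurableTypeR R := fun x => a * x.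
have mg : measurable_fun setT g.
  exact: (mulrl_measurable a).
apply: (@lebesgue_measure_unique R (mscale (NngNum (ltW a0))
  (pushforward mu g))) => // _ [[u v]] _ <-.
rewrite [RHS](_ : _ = a%:E * mu (g @^-1` `]u, v]%classic))%E//.
have -> : g @^-1` `]u, v]%classic = `]a^-1 * u, a^-1 * v]%classic.
  apply/seteqP; split => x; rewrite /= /g !in_itv/=.
    by rewrite ltr_pdivrMl// ler_pdivlMl.
  by rewrite ltr_pdivrMl// ler_pdivlMl.
rewrite !lebesgue_measure_itv/= !lte_fin ltr_pM2l ?invr_gt0//.
case: ifPn => _; last by rewrite mule0.
by rewrite -!EFinD -EFinM mulrBr !mulrA divff ?gt_eqF// !mul1r.
Qed.

(** By the Lebesgue density theorem almost all points of A are density points,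
so a set of positive measure contains one. *)
Lemma measure_gt0_density A (c : R) : measurable A -> (0 < mu A)%E -> c < 1 ->
  exists2 t, A t & exists2 e, 0 < e &
    forall r, 0 < r < e -> ((c * (r *+ 2))%:E < mu (A `&` ball t r))%E.
Proof.
move=> mA A0 c1.
have [t [At]] : exists t, A t /\
    (mu (A `&` ball t r) * (mu (ball t r))^-1)%E @[r --> 0^'+] --> (\1_A t)%:E.
  apply: contrapT => /forallNP nA; move: A0.
  rewrite (negligibleP mu mA).1 ?ltxx//.
  by apply: negligibleS (lebesgue_density mA) => t At dt; apply: (nA t).
rewrite indicE mem_set// => /(_ _ (@open_ereal_gt' _ 1%E c%:E _)).
rewrite lte_fin => /(_ c1) /nbhs_ballP[e /= e0 He].
exists t => //; exists e => // r /andP[r0 re].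
have := He r _ r0; rewrite /= lebesgue_measure_ball ?ltW// inver.
rewrite mulrn_eq0/= (gt_eqF r0).
rewrite lte_pdivlMr ?mulrn_wgt0// -EFinM; apply.
by rewrite -ball_normE/= sub0r normrN gtr0_norm.
Qed.

(** Let t and s be density points of A and B, and take balls around them whose
radii are the same small proportion k of their centres. A rational q slightly
below s / t turns the ball at s into a ball at p = s / q, slightly above t, that
almost coincides with the ball at t. As A and the dilate of B each fill more
than three quarters of these two balls, they are too big to be disjoint. *)
Lemma rat_ratio_measure_gt0 A B : measurable A -> measurable B ->
  A `<=` `]0, +oo[ -> B `<=` `]0, +oo[ -> (0 < mu A)%E -> (0 < mu B)%E ->
  exists2 q : rat, 0 < q & exists2 x, A x & B (ratr q * x).
Proof.
move=> mA mB Apos Bpos muA muB.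
have c1 : 3 / 4 < 1 :> R by lra.
have [t At [d d0 tA]] := measure_gt0_density mA muA c1.
have [s Bs [e e0 sB]] := measure_gt0_density mB muB c1.
have {At} t0 : 0 < t by move/Apos: At; rewrite /= in_itv/= andbT.
have {Bs} s0 : 0 < s by move/Bpos: Bs; rewrite /= in_itv/= andbT.
(* Both k * t < d and k * s < e are needed, as well as k < 1. *)
pose k := Num.min 1 (Num.min (d / t) (e / s)) / 2.
have m0 : 0 < Num.min 1 (Num.min (d / t) (e / s)).
  by rewrite !lt_min ltr01 !divr_gt0.
have k0 : 0 < k by rewrite divr_gt0.
have : k < Num.min 1 (Num.min (d / t) (e / s)).
  by rewrite ltr_pdivrMr// ltr_pMr// ltr1n.
rewrite !lt_min !ltr_pdivlMr// => /and3P[k1 kd ke].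
(* This window puts p = s / q in the interval ]t, t * (1 + k / 3)[: the shift
   k * t / 3 is small against the radius k * t. *)
have [q] : exists q, ratr q \in `](s / (t * (1 + k / 3))), (s / t)[.
  apply: rat_in_itvoo; rewrite ltr_pM2l// ltf_pV2 ?posrE ?mulr_gt0//; last lra.
  by rewrite ltr_pMr//; lra.
rewrite in_itv/= => /andP[q1 q2].
have q0 : 0 < ratr q :> R.
  by apply: lt_trans q1; rewrite divr_gt0// mulr_gt0//; lra.
pose p := s / ratr q.
have tp : t < p by rewrite ltr_pdivlMr// mulrC -ltr_pdivlMr.
have pt : p < t * (1 + k / 3).
  by rewrite ltr_pdivrMr// mulrC -ltr_pdivrMr// mulr_gt0//; lra.
exists q; first by rewrite -(ltr0q R).
apply: contrapT => noq.
pose E := A `&` ball t (k * t).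
pose F := [set x | (B `&` ball s (k * s)) (ratr q * x)].
have mBs : measurable (B `&` ball s (k * s)).
  by apply: measurableI => //; exact: measurable_ball.
have mE : measurable E by apply: measurableI => //; exact: measurable_ball.
have mF : measurable F by exact: measurable_scale.
have EF0 : E `&` F = set0.
  rewrite -subset0 => x [[Ax _] [Bx _]]; apply: noq; by exists x.
have muE : ((3 / 2 * (k * t))%:E < mu E)%E.
  have -> : 3 / 2 * (k * t) = 3 / 4 * (k * t *+ 2) by rewrite mulr2n; field.
  by apply: tA; rewrite mulr_gt0.
have muF : ((3 / 2 * (k * p))%:E < mu F)%E.
  rewrite -(@lte_pmul2l _ (ratr q)%:E) ?lte_fin//.
  rewrite -(lebesgue_measure_scale mBs q0) -EFinM.
  have -> : ratr q * (3 / 2 * (k * p)) = 3 / 4 * (k * s *+ 2).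
    by rewrite /p mulr2n; field; rewrite gt_eqF.
  by apply: sB; rewrite mulr_gt0.
have EFitv : E `|` F `<=` `]t - k * t, p + k * p[.
  move=> x; rewrite /= in_itv/= => -[[_]|[_]];
    rewrite ball_itv/= in_itv/= => /andP[x1 x2].
    by rewrite x1/= (lt_trans x2)// ltrD// ltr_pM2l.
  have -> : p + k * p = (s + k * s) / ratr q by rewrite /p mulrDl mulrA.
  rewrite ltr_pdivlMr// [x * _]mulrC x2 andbT.
  have : (s - k * s) / ratr q < x by rewrite ltr_pdivrMr// [x * _]mulrC.
  apply: le_lt_trans; have -> : (s - k * s) / ratr q = p - k * p.
    by rewrite /p mulrBl mulrA.
  have : 0 < (1 - k) * (p - t) by rewrite mulr_gt0 ?subr_gt0.
  lra.
have : (mu (E `|` F) <= (p + k * p - (t - k * t))%:E)%E.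
  have -> : (p + k * p - (t - k * t))%:E = mu `]t - k * t, p + k * p[%classic.
    rewrite lebesgue_measure_itv/= lte_fin ifT ?EFinB//.
    rewrite (@lt_trans _ _ t)// ?ltrBlDr ?ltrDl ?mulr_gt0//.
    by rewrite (lt_trans tp)// ltrDl mulr_gt0// (lt_trans t0).
  apply: le_measure; rewrite ?inE//; exact: measurableU.
(* More than 3/2 * k * (t + p) of measure inside an interval of length
   (p - t) + k * (t + p), although p - t < k * t / 3. *)
rewrite measureU// leNgt => /negP; apply.
apply: le_lt_trans (lteD muE muF); rewrite -EFinD lee_fin.
have : k * t < k * p by rewrite ltr_pM2l.
have : p < t + k * t / 3 by have := pt; lra.
have : 0 < k * t by rewrite mulr_gt0.
lra.
Qed.

End scaling.

Section measure.
Context {R : realType}.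
Local Notation mu := (@lebesgue_measure R).
Implicit Types A B : set R.

Lemma measurable_rat_saturation A :
  measurable A -> measurable (rat_saturation A).
Proof.
move=> mA; rewrite rat_saturationE; apply: bigcupT_measurable => n.
exact: measurable_scale.
Qed.

(** The Lebesgue sigma-algebra is the completion of the Borel one; X is the
Borel part of A, and W a Borel null set that covers the rest. This reduces the
argument to Borel sets, for which dilations are measurable. *)
Lemma lebesgue_measurable_decomp (A : set R) : lebesgue_measurable A ->
  exists X W : set R, [/\ measurable X, measurable W, mu W = 0%E, X `<=` A &
    A `<=` X `|` W].
Proof.
rewrite /lebesgue_measurable -[measurable]completed_caratheodory_measurable.
rewrite g_sigma_completed_algebra_genE => -[X mX [N [W [mW W0 NW]]] <-].
exists X, W; split => //; exact: setUS.
Qed.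

(** The ratios in the definition of a density point all vanish when A is
covered by a Borel null set, so they cannot tend to 1. *)
Lemma density_point_nonnull A B (t : R) : measurable B -> mu B = 0%E ->
  A `<=` B -> ~ density_point A t.
Proof.
move=> mB B0 AB; rewrite /density_point.
have -> : (fun d : R => completed_lebesgue_measure
    (A `&` [set` `]t - d / 2, t + d / 2[%R]) * (d^-1)%:E)%E = cst 0%E.
  apply/funext => d; suff -> : completed_lebesgue_measure
    (A `&` [set` `]t - d / 2, t + d / 2[%R]) = 0%E by rewrite mul0e.
  apply/eqP; rewrite eq_le measure_ge0 andbT -B0; apply: le_outer_measure.
  by move=> x [/AB].
move=> /(cvg_lim (@ereal_hausdorff R)).
rewrite lim_cst; last exact: ereal_hausdorff.
by move=> [] /esym/eqP; rewrite oner_eq0.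
Qed.

Lemma ess_bounded_of_rat_orbits (V : set R) (f : R -> R) :
  V `<=` `]0, +oo[ -> V !=set0 -> density_open V ->
  lebesgue_measurable_fun_pos f ->
  (forall x, V x -> (rat_orbit_sup f x < +oo)%E) ->
  ess_bounded_at_infinity f.
Proof.
move=> Vpos [v Vv] [_ dV] mf supf.
have /choice[X /choice[W mXW]] n : exists X W : set R,
    [/\ measurable X, measurable W, mu W = 0%E, X `<=` superlevel f n &
    superlevel f n `<=` X `|` W].
  apply: lebesgue_measurable_decomp; apply: mf; last exact: measurable_itv.
  exact: lebesgue_measurable_itv.
have [mX mW W0 XP PXW] : [/\ forall n, measurable (X n),
  forall n, measurable (W n), forall n, mu (W n) = 0%E,
  forall n, X n `<=` superlevel f n &
  forall n, superlevel f n `<=` X n `|` W n].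
  by split=> n; have [] := mXW n.
pose B n := `]0, +oo[ `\` rat_saturation (X n).
pose C n := `]0, +oo[ `&` rat_saturation (X n).
have mB n : measurable (B n).
  by apply: measurableD => //; exact: measurable_rat_saturation.
have mC n : measurable (C n).
  by apply: measurableI => //; exact: measurable_rat_saturation.
have [n Bn] : exists n, (0 < mu (B n))%E.
  apply: contrapT => /forallNP B0.
  have mBU : measurable (\bigcup_n B n) by exact: bigcupT_measurable.
  apply: (density_point_nonnull mBU _ _ (dV v Vv)).
    apply/(negligibleP mu mBU)/negligible_bigcup => n.
    apply/negligibleP; first exact: mB.
    by apply/eqP; rewrite eq_le measure_ge0 andbT leNgt; apply/negP/B0.
  move=> x Vx; have [n nx] := rat_orbit_sup_superlevel (supf x Vx).
  exists n => //; split; first exact: Vpos.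
  by move=> [q q0 /XP Pq]; apply: nx; exists q.
(* B n and C n split the half-line into invariant parts, so no rational
   dilation leads from one to the other. *)
have C0 : mu (C n) = 0%E.
  apply/eqP; rewrite eq_le measure_ge0 andbT leNgt; apply/negP => Cn.
  have [q q0 [x [_ Bx] [_ /rat_saturation_scale Cx]]] :=
    rat_ratio_measure_gt0 (mB n) (mC n)
      (@subIsetl _ _ _) (@subIsetl _ _ _) Bn Cn.
  exact/Bx/Cx.
exists n%:R; near=> m; apply: ereal_inf_lbound => /=.
(* The interval up to m only serves to cover the points outside the domain of
   the restricted measure. *)
have mCNm : measurable (C n `|` W n `|` `]-oo, m%:R]).
  apply: measurableU; last exact: measurable_itv.
  by apply: measurableU; [exact: mC|exact: mW].
exists (C n `|` W n `|` `]-oo, m%:R]); split.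
- exact: sub_caratheodory.
- apply/eqP; rewrite eq_le measure_ge0 andbT.
  have <- : mu (C n `|` W n) = 0%E.
    by rewrite measureU0; [exact: C0|exact: mC|exact: mW|exact: W0].
  apply: le_outer_measure => x [[]//]; rewrite /= !in_itv/= andbT => xm mx.
  by move: mx; rewrite ltNge xm.
- move=> x /=; rewrite lee_fin => fx; have [xm|mx] := leP x m%:R.
    by right; rewrite /= in_itv.
  have x0 : 0 < x by exact: le_lt_trans mx.
  have /PXW[Xx|] : superlevel f n x.
  - by split; rewrite /= in_itv/= ?x0// andbT ltNge; apply/negP.
  - by left; left; split; [rewrite /= in_itv/= x0|exact: sub_rat_saturation].
  - by left; right.
Unshelve. all: by end_near. Qed.

End measure.

Theorem theorem4p4 (R : realType) :
  (forall (V : set R) (f : R -> R),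
      V `<=` `]0, +oo[ -> V !=set0 -> density_open V ->
      lebesgue_measurable_fun_pos f ->
      (forall x, V x -> (rat_orbit_sup f x < +oo)%E) ->
      ess_bounded_at_infinity f)
  /\
  (forall (V : set R) (f : R -> R),
      V `<=` `]0, +oo[ -> V !=set0 -> open V ->
      baire_property_fun_pos f ->
      (forall x, V x -> (rat_orbit_sup f x < +oo)%E) ->
      category_ess_bounded_at_infinity f).
Proof.
split=> V f; first exact: ess_bounded_of_rat_orbits.
exact: category_ess_bounded_of_rat_orbits.
Qed.
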